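(* Suppose $v\in\mathfrak U_{\mathrm{SSM}}$ is a precise control such that for some positive constants $C_1,C_2,\beta$ and $k\ge2$, $$\mathcal L^v\mathcal V_{k,\beta}(x)\;\le\;C_1-C_2\,\mathcal V_{k,\beta}(x)\qquad\forall\,x\in\mathbb R^2 .$$ Let $\hat X^n$ denote the diffusion-scaled state process under the scheduling policy $z^n[v]$ and let $\widehat{\mathcal L}_n$ be its generator. Then there exist $n_0\in\mathbb N$ and positive constants $C_1',C_2'$ such that $$\widehat{\mathcal L}_n\mathcal V_{k,\beta}(\hat x)\;\le\;C_1'-C_2'\,\mathcal V_{k,\beta}(\hat x)\qquad\forall\,\hat x\in\breve{\mathcal S}^n,\ \forall\,n\ge n_0 .$$
   Context: **Notation.** $e=(1,1)^{\mathsf T}$, $e_1=(1,0)$, $e_2=(0,1)$; $a\wedge b=\min(a,b)$, $a^+=\max(a,0)$, $a^-=-\min(a,0)$; $\|x\|=|x_1|+|x_2|$. **N-network.** For each $n\in\mathbb N$ there are two customer classes $i=1,2$ and two server pools $j=1,2$ with $N_j^n$ identical servers in pool $j$. Pool 1 serves only class 1; pool 2 serves both classes. Class-$i$ jobs arrive as a Poisson process of rate $\lambda_i^n$; class-1 jobs are served at exponential rates $\mu_{11}^n,\mu_{12}^n$ in pools 1, 2, class-2 jobs at exponential rate $\mu_{22}^n$ in pool 2; waiting class-$i$ jobs abandon at exponential rate $\gamma_i^n$. Standing assumption: as $n\to\infty$, for $i,j\in\{1,2\}$, $\lambda_i^n/n\to\lambda_i>0$, $(\lambda_i^n-n\lambda_i)/\sqrt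 n\to\hat\lambda_i$, $\gamma_i^n\to\gamma_i\ge0$, $N_j^n/n\to\nu_j>0$, $\sqrt n(n^{-1}N_j^n-\nu_j)\to0$; for $(i,j)\in\{(1,1),(1,2),(2,2)\}$, $\mu_{ij}^n\to\mu_{ij}>0$, $\sqrt n(\mu_{ij}^n-\mu_{ij})\to\hat\mu_{ij}$; and $\lambda_1>\mu_{11}\nu_1$, $\frac{\lambda_1-\mu_{11}\nu_1}{\mu_{12}\nu_2}+\frac{\lambda_2}{\mu_{22}\nu_2}=1$. Put $z_{11}^*=\nu_1$, $z_{12}^*=\frac{\lambda_1-\mu_{11}\nu_1}{\mu_{12}}$, $z_{22}^*=\frac{\lambda_2}{\mu_{22}}$, $x_1^*=z_{11}^*+z_{12}^*$, $x_2^*=z_{22}^*$. **Action sets.** For $x\in\mathbb Z_+^2$, $z\in\mathbb Z_+^{2\times2}$ let $q_1(x,z)=x_1-z_{11}-z_{12}$, $q_2(x,z)=x_2-z_{22}$, $y_1^n(x,z)=N_1^n-z_{11}$, $y_2^n(x,z)=N_2^n-z_{12}-z_{22}$; $\mathcal Z^n(x)$ is the set of $z\in\mathbb Z_+^{2\times2}$ with $z_{21}=0$, $q_1,q_2,y_1^n,y_2^n\ge0$, $q_1\wedge(y_1^n+y_2^n)=0$, $q_2\wedge y_2^n=0$. Let $c_0>0$ be a constant (it is known to exist) such that with $\breve{\mathcal X}^n=\{x\in\mathbb Z_+^2:\|x-nx^*\|\le c_0n\}$, for all $n$, all $x\in\breve{\mathcal X}^n$ and all $q,y\in\mathbb Z_+^2$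 with $(e\cdot q)\wedge(e\cdot y)=0$ and $e\cdot(x-q)=e\cdot(N^n-y)\ge0$, the matrix $\begin{bmatrix}N_1^n-y_1&x_1-q_1-(N_1^n-y_1)\\0&x_2-q_2\end{bmatrix}$ lies in $\mathcal Z^n(x)$. Let $\hat x^n(x)=n^{-1/2}(x-nx^* )$, $\mathcal S^n=\{\hat x^n(x):x\in\mathbb Z_+^2\}$, $\breve{\mathcal S}^n=\{\hat x^n(x):x\in\breve{\mathcal X}^n\}$. **Limiting diffusion.** $\mathbb U=\{u=(u^c,u^s)\in\mathbb R_+^2\times\mathbb R_+^2:e\cdot u^c=e\cdot u^s=1\}$; $dX_t=b(X_t,U_t)dt+\Sigma\,dW_t$ on $\mathbb R^2$, $W$ a standard 2-dimensional Wiener process, $b(x,u)=-B_1(x-(e\cdot x)^+u^c)+(e\cdot x)^-B_2u^s-(e\cdot x)^+\Gamma u^c+\ell$, with $B_1=\mathrm{diag}(\mu_{12},\mu_{22})$, $B_2=\mathrm{diag}(\mu_{11}-\mu_{12},0)$, $\Gamma=\mathrm{diag}(\gamma_1,\gamma_2)$, $\ell_1=\hat\lambda_1-\hat\mu_{11}z_{11}^*-\hat\mu_{12}z_{12}^*$, $\ell_2=\hat\lambda_2-\hat\mu_{22}z_{22}^*$, $\Sigma=\mathrm{diag}(\sqrt{2\lambda_1},\sqrt{2\lambda_2})$. $\mathcal L^uf(x)=\sum_{i=1}^2[\lambda_i\partial_{ii}f(x)+b_i(x,u)\partial_if(x)]$ and $\mathcal L^vf(x)=\mathcal L^{v(x)}f(x)$.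 $\mathfrak U_{\mathrm{SSM}}$ is the set of stationary Markov controls $U_t=v(X_t)$ under which the diffusion is positive recurrent; a precise control is an ordinary measurable function $v=(v^c,v^s):\mathbb R^2\to\mathbb U$. **The policy $z^n[v]$ and its generator.** For $x\in\mathbb R_+^2$ with $e\cdot x\in\mathbb Z$ put $\varpi(x)=(\lfloor x_1\rfloor,\ e\cdot x-\lfloor x_1\rfloor)$. For $\hat x\in\mathcal S^n$, with $x=\sqrt n\hat x+nx^*\in\mathbb Z_+^2$ and $N^n=(N^n_1,N^n_2)$: $q^n[v](\hat x)=\varpi\big((e\cdot x-e\cdot N^n)^+v^c(\hat x)\big)$, $y^n[v](\hat x)=\varpi\big((e\cdot x-e\cdot N^n)^-v^s(\hat x)\big)$, and for $\hat x\in\breve{\mathcal S}^n$, $z^n[v](\hat x)=\begin{bmatrix}N_1^n-y_1^n[v](\hat x)&x_1-q_1^n[v](\hat x)-(N_1^n-y_1^n[v](\hat x))\\0&x_2-q_2^n[v](\hat x)\end{bmatrix}$. For $\hat x=\hat x^n(x)\in\breve{\mathcal S}^n$, $\widehat{\mathcal L}_nf(\hat x)=\mathcal L_n(f\circ\hat x^n)(x)$ where, with $z=z^n[v](\hat x)$ and $q=q^n[v](\hat x)$, $\mathcal L_ng(x)=\sum_{i=1}^2\lambda_i^n(g(x+e_i)-g(x))+(\mu_{11}^nz_{11}+\mu_{12}^nz_{12})(g(x-e_1)-g(x))+\mu_{22}^nz_{22}(g(x-e_2)-g(x))+\sum_{i=1}^2\gamma_i^nq_i(g(x-e_i)-g(x))$.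 **Lyapunov function.** $\mathcal V_{k,\beta}(x)=|x_1|^k+\beta|x_2|^k$. *)

(* Defs.v *)
From HB Require Import structures.
From mathcomp Require Import all_boot all_order all_algebra.
From mathcomp Require Import all_classical all_reals all_analysis.

Set Implicit Arguments.
Unset Strict Implicit.
Unset Printing Implicit Defensive.

Import Order.TTheory GRing.Theory Num.Theory.
Import numFieldNormedType.Exports.

Local Open Scope classical_set_scope.
Local Open Scope ring_scope.

(* Points of R^2 are pairs, so that the library's product topology, norm and
   (Borel) sigma-algebra apply.  2x2 matrices are indexed from 0: the entry
   z_{ij} of the mathematics is z (i-1) (j-1).  Integer-valued quantities
   (states, queues, allocations) are kept in R and constrained by Num.nat. *)

Section Plane.
Context {R : realType}.
Implicit Types (a : R) (x d : R * R).

Definition pos a : R := Num.max a 0.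
Definition neg a : R := - Num.min a 0.

Definition e1 : R * R := (1, 0).
Definition e2 : R * R := (0, 1).

Definition edot x : R := x.1 + x.2.

Definition norm1 x : R := `|x.1| + `|x.2|.

Definition diagv d x : R * R := (d.1 * x.1, d.2 * x.2).

Definition Zplus2 : set (R * R) :=
  [set x | x.1 \is a Num.nat /\ x.2 \is a Num.nat].

Definition mx22 (a b c d : R) : 'M[R]_2 :=
  \matrix_(i < 2, j < 2)
    if i == 0 then (if j == 0 then a else b) else (if j == 0 then c else d).

(* Used for x >= 0 with x.1 + x.2 an integer: then varpi x is in Z_+^2. *)
Definition varpi x : R * R :=
  ((Num.floor x.1)%:~R, edot x - (Num.floor x.1)%:~R).

Definition Vlyap (k beta : R) x : R := `|x.1| `^ k + beta * `|x.2| `^ k.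

(* A control value is u = (u^c, u^s). *)
Definition Uset : set ((R * R) * (R * R)) :=
  [set u | [/\ 0 <= u.1.1, 0 <= u.1.2, 0 <= u.2.1 & 0 <= u.2.2] /\
           edot u.1 = 1 /\ edot u.2 = 1].

Definition precise_control (v : R * R -> (R * R) * (R * R)) : Prop :=
  measurable_fun [set: R * R] v /\ forall x, Uset (v x).

End Plane.

(* Fields ending in n are the parameters of the n-th system; lam, gam, nu, mu11,
   mu12, mu22 are their limits, hlam and hmu11, hmu12, hmu22 the second order
   limits. *)
Record nnetwork (R : realType) := NNetwork {
  lamn : nat -> R * R;
  gamn : nat -> R * R;
  mu11n : nat -> R;
  mu12n : nat -> R;
  mu22n : nat -> R;
  poolsn : nat -> nat * nat;
  lam : R * R;
  hlam : R * R;
  gam : R * R;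
  nu : R * R;
  mu11 : R;
  mu12 : R;
  mu22 : R;
  hmu11 : R;
  hmu12 : R;
  hmu22 : R }.

Section Network.
Context {R : realType} (net : nnetwork R).
Implicit Types (n : nat) (x q y : R * R) (z : 'M[R]_2).

Definition Nn n : R * R := ((poolsn net n).1%:R, (poolsn net n).2%:R).

Definition standing : Prop :=
  [/\ forall n, (0 < n)%N ->
        [/\ 0 <= (lamn net n).1 /\ 0 <= (lamn net n).2,
            0 <= (gamn net n).1 /\ 0 <= (gamn net n).2 &
            [/\ 0 <= mu11n net n, 0 <= mu12n net n & 0 <= mu22n net n]],
      [/\ n%:R^-1 *: lamn net n @[n --> \oo] --> lam net,
          (Num.sqrt n%:R)^-1 *: (lamn net n - n%:R *: lam net) @[n --> \oo]
            --> hlam net,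
          gamn net n @[n --> \oo] --> gam net,
          n%:R^-1 *: Nn n @[n --> \oo] --> nu net &
          Num.sqrt n%:R *: (n%:R^-1 *: Nn n - nu net) @[n --> \oo]
            --> (0 : R * R)],
      [/\ mu11n net n @[n --> \oo] --> mu11 net,
          mu12n net n @[n --> \oo] --> mu12 net &
          mu22n net n @[n --> \oo] --> mu22 net] /\
      [/\ Num.sqrt n%:R * (mu11n net n - mu11 net) @[n --> \oo] --> hmu11 net,
          Num.sqrt n%:R * (mu12n net n - mu12 net) @[n --> \oo] --> hmu12 net &
          Num.sqrt n%:R * (mu22n net n - mu22 net) @[n --> \oo] --> hmu22 net],
      [/\ 0 < (lam net).1 /\ 0 < (lam net).2,
          0 <= (gam net).1 /\ 0 <= (gam net).2,
          0 < (nu net).1 /\ 0 < (nu net).2 &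
          [/\ 0 < mu11 net, 0 < mu12 net & 0 < mu22 net]] &
      mu11 net * (nu net).1 < (lam net).1 /\
      ((lam net).1 - mu11 net * (nu net).1) / (mu12 net * (nu net).2)
        + (lam net).2 / (mu22 net * (nu net).2) = 1].

Definition zstar11 : R := (nu net).1.
Definition zstar12 : R := ((lam net).1 - mu11 net * (nu net).1) / mu12 net.
Definition zstar22 : R := (lam net).2 / mu22 net.
Definition xstar : R * R := (zstar11 + zstar12, zstar22).

Definition q1 x z : R := x.1 - z 0 0 - z 0 1.
Definition q2 x z : R := x.2 - z 1 1.
Definition y1 n z : R := (Nn n).1 - z 0 0.
Definition y2 n z : R := (Nn n).2 - z 0 1 - z 1 1.

Definition Zset n x : set 'M[R]_2 :=
  [set z : 'M[R]_2 | (forall i j, z i j \is a Num.nat) /\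
     [/\ z 1 0 = 0,
         [/\ 0 <= q1 x z, 0 <= q2 x z, 0 <= y1 n z & 0 <= y2 n z],
         Num.min (q1 x z) (y1 n z + y2 n z) = 0 &
         Num.min (q2 x z) (y2 n z) = 0]].

Definition zalloc n x q y : 'M[R]_2 :=
  mx22 ((Nn n).1 - y.1) (x.1 - q.1 - ((Nn n).1 - y.1))
       0                (x.2 - q.2).

Definition breveX (c0 : R) n : set (R * R) :=
  [set x | Zplus2 x /\ norm1 (x - n%:R *: xstar) <= c0 * n%:R].

(* The index n ranges over n >= 1: the scaling below is by n^{-1/2}. *)
Definition jwc_radius (c0 : R) : Prop :=
  forall n, (0 < n)%N -> forall x q y,
    breveX c0 n x -> Zplus2 q -> Zplus2 y ->
    Num.min (edot q) (edot y) = 0 ->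
    edot (x - q) = edot (Nn n - y) -> 0 <= edot (Nn n - y) ->
    Zset n x (zalloc n x q y).

Definition hatx n x : R * R := (Num.sqrt n%:R)^-1 *: (x - n%:R *: xstar).

Definition unhatx n (xh : R * R) : R * R := Num.sqrt n%:R *: xh + n%:R *: xstar.

Definition breveS (c0 : R) n : set (R * R) := hatx n @` breveX c0 n.

Definition ell : R * R :=
  ((hlam net).1 - hmu11 net * zstar11 - hmu12 net * zstar12,
   (hlam net).2 - hmu22 net * zstar22).

Definition drift x (u : (R * R) * (R * R)) : R * R :=
  - diagv (mu12 net, mu22 net) (x - pos (edot x) *: u.1)
  + neg (edot x) *: diagv (mu11 net - mu12 net, 0) u.2
  - pos (edot x) *: diagv (gam net) u.1
  + ell.

Definition sigma : R * R :=
  (Num.sqrt (2 * (lam net).1), Num.sqrt (2 * (lam net).2)).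

Definition Lgen (u : (R * R) * (R * R)) (f : R * R -> R) x : R :=
  ((lam net).1 * 'D_e1 ('D_e1 f) x + (drift x u).1 * 'D_e1 f x)
  + ((lam net).2 * 'D_e2 ('D_e2 f) x + (drift x u).2 * 'D_e2 f x).

Section Policy.
Variable v : R * R -> (R * R) * (R * R).

Definition qpol n (xh : R * R) : R * R :=
  varpi (pos (edot (unhatx n xh) - edot (Nn n)) *: (v xh).1).

Definition ypol n (xh : R * R) : R * R :=
  varpi (neg (edot (unhatx n xh) - edot (Nn n)) *: (v xh).2).

Definition zpol n (xh : R * R) : 'M[R]_2 :=
  zalloc n (unhatx n xh) (qpol n xh) (ypol n xh).

Definition gen n z q (g : R * R -> R) x : R :=
  ((lamn net n).1 * (g (x + e1) - g x) + (lamn net n).2 * (g (x + e2) - g x))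
  + (mu11n net n * z 0 0 + mu12n net n * z 0 1) * (g (x - e1) - g x)
  + mu22n net n * z 1 1 * (g (x - e2) - g x)
  + ((gamn net n).1 * q.1 * (g (x - e1) - g x)
     + (gamn net n).2 * q.2 * (g (x - e2) - g x)).

Definition hgen n (f : R * R -> R) (xh : R * R) : R :=
  gen n (zpol n xh) (qpol n xh) (f \o hatx n) (unhatx n xh).

End Policy.

End Network.

(* Since the noise is additive,
   dX = b dt + Sigma dW is an integral equation without stochastic integrals. *)

Section Diffusion.
Context {R : realType} {d : measure_display} {Omega : measurableType d}.
Variable P : probability Omega R.
Implicit Types (F : R -> set (set Omega)) (W X : R -> Omega -> R * R).

(* Time is t >= 0; values at t < 0 are irrelevant throughout. *)
Definition filtration F : Prop :=
  (forall t : R, 0 <= t -> sigma_algebra [set: Omega] (F t) /\ F t `<=` measurable)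
  /\ (forall s t : R, 0 <= s -> s <= t -> F s `<=` F t).

Definition adapted F X : Prop :=
  forall t : R, 0 <= t -> forall B : set (R * R), measurable B -> F t (X t @^-1` B).

Definition continuous_paths X : Prop :=
  forall w, {within `[0, +oo[, continuous (fun t => X t w)}.

(* The last clause says at once that W_t - W_s is independent of F_s and has
   law N(0, (t - s) I); normal_prob takes the standard deviation. *)
Definition wiener2 F W : Prop :=
  [/\ adapted F W, continuous_paths W, {ae P, forall w, W 0 w = 0} &
      forall s t : R, 0 <= s -> s < t ->
      forall (G : set Omega) (A B : set R),
        F s G -> measurable A -> measurable B ->
        P (G `&` [set w | A (W t w - W s w).1 /\ B (W t w - W s w).2]) =
        (P G * (normal_prob 0 (Num.sqrt (t - s)) A
                * normal_prob 0 (Num.sqrt (t - s)) B))%E].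

Definition diffusion_solution (net : nnetwork R)
    (v : R * R -> (R * R) * (R * R)) (x0 : R * R) F W X : Prop :=
  [/\ filtration F, wiener2 F W, adapted F X, continuous_paths X &
      {ae P, forall w, forall t : R, 0 <= t ->
         X t w = x0
           + (\int[lebesgue_measure]_(s in `[0, t])
                (drift net (X s w) (v (X s w))).1,
              \int[lebesgue_measure]_(s in `[0, t])
                (drift net (X s w) (v (X s w))).2)
           + diagv (sigma net) (W t w)}].

Definition hitting_time X (D : set (R * R)) (w : Omega) : \bar R :=
  ereal_inf [set t%:E | t in [set t : R | 0 <= t /\ D (X t w)]].

End Diffusion.

(* Weak solutions exist and are unique in law for each x0 (bounded measurable
   control, nondegenerate constant Sigma), so quantifying over all of them is
   the same as speaking of the law started at x0; the existence clause only
   keeps the definition from being vacuously true. *)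
Definition positive_recurrent (R : realType) (net : nnetwork R)
    (v : R * R -> (R * R) * (R * R)) : Prop :=
  forall x0 : R * R,
    (exists (d : measure_display) (Omega : measurableType d)
            (P : probability Omega R) (F : R -> set (set Omega))
            (W X : R -> Omega -> R * R),
       diffusion_solution P net v x0 F W X) /\
    (forall (d : measure_display) (Omega : measurableType d)
            (P : probability Omega R) (F : R -> set (set Omega))
            (W X : R -> Omega -> R * R),
       diffusion_solution P net v x0 F W X ->
       forall D : set (R * R), open D -> bounded_set D -> D !=set0 ->
         (\int[P]_w hitting_time X D w < +oo)%E).

Definition precise_SSM (R : realType) (net : nnetwork R)
    (v : R * R -> (R * R) * (R * R)) : Prop :=
  precise_control v /\ positive_recurrent net v.

(* Main.v *)
Require Import Defs.
From mathcomp Require Import all_boot all_order all_algebra.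
From mathcomp Require Import all_classical all_reals all_analysis.
From mathcomp Require Import ring lra.

Set Implicit Arguments.
Unset Strict Implicit.
Unset Printing Implicit Defensive.

Import Order.TTheory GRing.Theory Num.Theory.
Import numFieldNormedType.Exports.

Local Open Scope classical_set_scope.
Local Open Scope ring_scope.

(** The generator of the scaled chain is compared term by term with that of
the diffusion.  A jump of size [n^{-1/2}] in coordinate [i] changes
[|x_i|^k] by its first order part plus an error of order
[n^{-1} (1 + |x_i|)^(k-2)] ([norm_powR_taylor]).  On the states within [c0 n]
of the fluid equilibrium all transition rates are of order [n]
([fluid_rates1], [fluid_rates2]), so the second order errors add up to
[O((1 + |x|)^(k-2))], uniformly in [n].

The first order parts add up to the gradient of the Lyapunov function against
the scaled drift of the chain.  In that drift the terms of order [n^{1/2}]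
cancel because the system is critically loaded, and what remains is the drift
of the diffusion up to a bounded error and the term
[(gamma_i^n - gamma_i) (e.x)^+ u_i^c] ([scaled_drift1], [scaled_drift2]).
Abandonment rates converge without a speed, so this last term is only
[o(1) |x|]; all other fluctuations of the parameters are of order [n^{-1/2}] and
meet quantities of order at most [n^{1/2}] there, because [|x| <= c0 n^{1/2}].

Hence the generator of the chain exceeds [b . grad V] by at most
[K (1 + |x|)^(k-1) + o(1) (1 + |x|)^k].  Since [V] is convex, the second order
part of the generator of the diffusion is nonnegative, so the hypothesis bounds
[b . grad V] by [C1 - C2 V]; the excess is absorbed in half of [C2 V]
([absorb_lower_order]).

All estimates on powers come from one inequality, the tangent line inequality
for [y |-> y^p], which is Young's inequality ([powR_tangent]). *)

(** * Powers of the absolute value *)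

(** Convexity of the power function, in the form of Young's inequality for
[x * y ^ (p - 1)] with the exponents [p] and [p / (p - 1)]. *)
Lemma powR_tangent (R : realType) (p x y : R) :
  1 <= p -> 0 <= x -> 0 <= y -> y `^ p + p * y `^ (p - 1) * (x - y) <= x `^ p.
Proof.
move=> p1 x0 y0; have [->|pN1] := eqVneq p 1.
  by rewrite subrr powRr0 !powRr1//; lra.
have p_gt1 : 1 < p by rewrite lt_neqAle eq_sym pN1.
have p0 : 0 < p by lra.
have pV : p^-1 + (p / (p - 1))^-1 = 1.
  by rewrite invf_div; field; rewrite gt_eqF.
have := @conjugate_powR R x (y `^ (p - 1)) p (p / (p - 1)) x0 (powR_ge0 _ _) p0.
rewrite divr_gt0 ?subr_gt0// => /(_ isT pV).
have -> : (y `^ (p - 1)) `^ (p / (p - 1)) = y `^ p.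
  by rewrite -powRrM; congr (_ `^ _); field; rewrite subr_eq0.
rewrite invf_div -(ler_pM2l p0) => young.
have yp := mulr_powRB1 y0 p0.
have -> : y `^ p + p * y `^ (p - 1) * (x - y) =
    p * (x * y `^ (p - 1)) - (p - 1) * y `^ p by rewrite -yp; ring.
rewrite lerBlDr (le_trans young)// le_eqVlt; apply/orP; left; apply/eqP.
by field; rewrite gt_eqF.
Qed.

(** Up to the factor [a + 2], the derivative of [|t| ^ (a + 2)].  For [a = 0] it
is the identity, as [0 `^ 0 = 1]. *)
Definition signed_powR {R : realType} (a t : R) : R := t * `|t| `^ a.

Section SignedPower.
Context {R : realType}.
Implicit Types a k s t u m : R.

Lemma signed_powRN a t : signed_powR a (- t) = - signed_powR a t.
Proof. by rewrite /signed_powR normrN mulNr. Qed.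

Lemma le_norm_powR a t m : 0 <= a -> `|t| <= m -> `|t| `^ a <= m `^ a.
Proof.
move=> a0 tm; apply: ge0_ler_powR => //; rewrite nnegrE//.
exact: le_trans tm.
Qed.

Lemma signed_powR_homo a t u :
  0 <= a -> t <= u -> signed_powR a t <= signed_powR a u.
Proof.
move=> a0; have homo0 x y : 0 <= x -> x <= y ->
    signed_powR a x <= signed_powR a y.
  move=> x0 xy; apply: ler_pM; rewrite ?powR_ge0//.
  by rewrite (ger0_norm (le_trans x0 xy)) le_norm_powR// ger0_norm.
move=> tu; have [t0|t0] := leP 0 t; first exact: homo0.
have [u0|u0] := leP 0 u; last first.
  by rewrite -lerN2 -!signed_powRN homo0 ?lerN2// oppr_ge0 ltW.
rewrite (@le_trans _ _ 0)// /signed_powR ?mulr_ge0 ?powR_ge0//.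
by rewrite mulr_le0_ge0 ?powR_ge0// ltW.
Qed.

(** For [t] and [u] of the same sign this is the tangent inequality for the
exponent [a + 1]; for opposite signs the two terms do not compensate and each
of them is at most [m ^ a] times its distance to the origin. *)
Lemma signed_powR_lip a m t u : 0 <= a -> `|t| <= m -> `|u| <= m ->
  `|signed_powR a u - signed_powR a t| <= (a + 1) * m `^ a * `|u - t|.
Proof.
move=> a0; have lip0 x y : 0 <= x -> x <= y -> `|y| <= m ->
    signed_powR a y - signed_powR a x <= (a + 1) * m `^ a * (y - x).
  move=> x0 xy ym; have y0 := le_trans x0 xy.
  have a1 : 1 <= a + 1 by lra.
  have a1_gt0 : 0 < a + 1 by lra.
  have := @powR_tangent R (a + 1) x y a1 x0 y0.
  rewrite -(mulr_powRB1 x0 a1_gt0) -(mulr_powRB1 y0 a1_gt0) addrK.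
  rewrite /signed_powR !ger0_norm// => tangent.
  have : (a + 1) * y `^ a * (y - x) <= (a + 1) * m `^ a * (y - x).
    rewrite ler_wpM2r ?subr_ge0// ler_wpM2l//; first lra.
    by move: (le_norm_powR a0 ym); rewrite ger0_norm.
  by apply: le_trans; lra.
wlog tu : t u / t <= u => [hw|tm um].
  have [|/ltW] := leP t u; first exact: hw.
  by move=> ut tm um; rewrite distrC (distrC u) hw.
rewrite !ger0_norm ?subr_ge0 ?signed_powR_homo//.
have [t0|t0] := leP 0 t; first exact: lip0.
have [u0|u0] := leP 0 u; last first.
  have := lip0 (- u) (- t); rewrite !signed_powRN !opprK normrN.
  rewrite (addrC (- signed_powR a t)) (addrC (- t)).
  by apply; rewrite ?lerN2// oppr_ge0 ltW.
have mt := le_norm_powR a0 tm; have mu := le_norm_powR a0 um.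
apply: (@le_trans _ _ (m `^ a * (u - t))).
  rewrite mulrBr /signed_powR ![m `^ a * _]mulrC lerB//.
    exact: ler_wpM2l.
  by rewrite ler_wnM2l// ltW.
rewrite -mulrA ler_peMl ?lerDr//.
by rewrite mulr_ge0 ?powR_ge0// subr_ge0.
Qed.

Lemma norm_powR_tangent k t u : 2 <= k ->
  `|t| `^ k + k * signed_powR (k - 2) t * (u - t) <= `|u| `^ k.
Proof.
move=> k2; have k1 : 1 <= k by lra.
have k1_gt0 : 0 < k - 1 by lra.
apply: le_trans (powR_tangent k1 (normr_ge0 u) (normr_ge0 t)).
rewrite lerD2l -(mulr_powRB1 (normr_ge0 t) k1_gt0).
have -> : k - 1 - 1 = k - 2 by lra.
rewrite /signed_powR -!mulrA ler_wpM2l//; first lra.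
rewrite mulrCA [leRHS]mulrCA ler_wpM2l ?powR_ge0// !mulrBr lerB//.
  by rewrite -normrM ler_norm.
by rewrite -normrM ger0_norm// -expr2 sqr_ge0.
Qed.

(** The tangent inequality at [t] bounds the remainder from below by [0], and
the tangent inequality at [t + s] bounds it from above by the increment of the
derivative times [s], to which the Lipschitz bound applies.  No second derivative
is involved, so the origin needs no separate treatment when [k < 3]. *)
Lemma norm_powR_taylor k s t : 2 <= k -> `|s| <= 1 ->
  `| `|t + s| `^ k - `|t| `^ k - s * (k * signed_powR (k - 2) t)| <=
    k * (k - 1) * (1 + `|t|) `^ (k - 2) * s ^+ 2.
Proof.
move=> k2 s1; have k2_ge0 : 0 <= k - 2 by lra.
have lo := @norm_powR_tangent k t (t + s) k2.
have hi := @norm_powR_tangent k (t + s) t k2.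
have tm : `|t| <= 1 + `|t| by rewrite lerDr.
have tsm : `|t + s| <= 1 + `|t|.
  by rewrite addrC (le_trans (ler_normD _ _))// lerD2r.
have lip := signed_powR_lip k2_ge0 tm tsm.
rewrite ger0_norm; last lra.
apply: (@le_trans _ _
  (k * (s * (signed_powR (k - 2) (t + s) - signed_powR (k - 2) t)))); first lra.
rewrite -!mulrA ler_wpM2l//; first lra.
rewrite (_ : t + s - t = s) in lip; last ring.
rewrite (_ : k - 2 + 1 = k - 1) in lip; last ring.
rewrite (le_trans (ler_norm _))// normrM (le_trans (ler_wpM2l _ lip))//.
by rewrite -[s ^+ 2]real_normK ?num_real// le_eqVlt; apply/orP; left;
  apply/eqP; ring.
Qed.

End SignedPower.

(** * Derivatives of the Lyapunov function *)

Section Derivatives.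
Context {R : realType}.
Implicit Types (k beta h : R) (x e : R * R).

(** Where the limit of the difference quotients does not exist, [lim] takes the
default value [0], so that the conclusion holds there as well. *)
Lemma derive_ge0 (V : normedModType R) (f : V -> R) (x e : V) :
  (forall h, 0 < h -> f x <= f (h *: e + x)) ->
  (forall h, h < 0 -> f (h *: e + x) <= f x) -> 0 <= 'D_e f x.
Proof.
move=> fpos fneg; rewrite /derive.
set F := (X in lim (X @ _)).
have [cF|/dvgP ->] := pselect (cvg (F @ 0^')); last by rewrite /point /=.
apply: limr_ge => //; near=> h.
rewrite /F /= -[_ *: _]/(_ * _).
have [h0|h0|h0] := ltgtP h 0.
- by rewrite nmulr_rge0 ?invr_lt0// subr_le0 fneg.
- by rewrite mulr_ge0 ?invr_ge0 ?(ltW h0)// subr_ge0 fpos.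
- by rewrite h0 invr0 mul0r.
Unshelve. all: by end_near. Qed.

Lemma derive_of_taylor (V : normedModType R) (f : V -> R) (x e : V) (l M : R) :
  (forall h, `|h| <= 1 -> `|f (h *: e + x) - f x - h * l| <= M * h ^+ 2) ->
  'D_e f x = l.
Proof.
move=> taylor; rewrite /derive; apply/cvg_lim => //.
apply/cvgrPdist_le => eps eps0.
have M0 : 0 <= M.
  have := taylor 1; rewrite normr1 expr1n mulr1 => /(_ (lexx _)).
  exact: le_trans.
near=> h.
have h1 : `|h| <= 1.
  by near: h; apply: nbhs_dnbhs; exists 1 => //= y /=;
    rewrite sub0r normrN => /ltW.
have heps : `|h| <= eps / (M + 1).
  near: h; apply: nbhs_dnbhs; exists (eps / (M + 1)) => /=.
    by rewrite divr_gt0//; lra.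
  by move=> y /=; rewrite sub0r normrN => /ltW.
have hN0 : h != 0 by near: h; exact: nbhs_dnbhs_neq.
rewrite /= -[_ *: _]/(_ * _) distrC.
have -> : h^-1 * (f (h *: e + x) - f x) - l =
    h^-1 * (f (h *: e + x) - f x - h * l) by field.
rewrite normrM normfV mulrC ler_pdivrMr ?normr_gt0//.
rewrite (le_trans (taylor _ h1))//.
rewrite -[h ^+ 2]real_normK ?num_real// expr2 mulrA ler_wpM2r//.
rewrite (le_trans (ler_wpM2l M0 heps))// mulrA ler_pdivrMr; lra.
Unshelve. all: by end_near. Qed.

Lemma scale_e1D h x : h *: e1 + x = (h + x.1, x.2).
Proof.
rewrite [in LHS](surjective_pairing x) /e1 -[_ *: _]/(h * 1, h * 0) /=.
by rewrite mulr1 mulr0 -[_ + _]/(h + x.1, 0 + x.2) add0r.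
Qed.

Lemma scale_e2D h x : h *: e2 + x = (x.1, h + x.2).
Proof.
rewrite [in LHS](surjective_pairing x) /e2 -[_ *: _]/(h * 0, h * 1) /=.
by rewrite mulr1 mulr0 -[_ + _]/(0 + x.1, h + x.2) add0r.
Qed.

Lemma derive_e1_Vlyap k beta x : 2 <= k ->
  'D_e1 (Vlyap k beta) x = k * signed_powR (k - 2) x.1.
Proof.
move=> k2; apply: (derive_of_taylor
  (M := k * (k - 1) * (1 + `|x.1|) `^ (k - 2))) => h h1.
rewrite scale_e1D /Vlyap /= (addrC h).
rewrite [X in X - _](_ : _ = `|x.1 + h| `^ k - `|x.1| `^ k); last by ring.
exact: norm_powR_taylor.
Qed.

Lemma derive_e2_Vlyap k beta x : 2 <= k -> 0 < beta ->
  'D_e2 (Vlyap k beta) x = beta * (k * signed_powR (k - 2) x.2).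
Proof.
move=> k2 b0; apply: (derive_of_taylor
  (M := beta * (k * (k - 1) * (1 + `|x.2|) `^ (k - 2)))) => h h1.
rewrite scale_e2D /Vlyap /= (addrC h).
rewrite [X in `|X|](_ : _ = beta * (`|x.2 + h| `^ k - `|x.2| `^ k -
  h * (k * signed_powR (k - 2) x.2))); last by ring.
rewrite normrM gtr0_norm//.
by rewrite -[leRHS]mulrA ler_wpM2l ?(ltW b0)// norm_powR_taylor.
Qed.

Lemma derive2_e1_Vlyap_ge0 k beta x : 2 <= k ->
  0 <= 'D_e1 ('D_e1 (Vlyap k beta)) x.
Proof.
move=> k2; apply: derive_ge0 => h h0; rewrite !derive_e1_Vlyap// scale_e1D;
  rewrite ler_wpM2l;
  try lra; rewrite signed_powR_homo//=; lra.
Qed.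

Lemma derive2_e2_Vlyap_ge0 k beta x : 2 <= k -> 0 < beta ->
  0 <= 'D_e2 ('D_e2 (Vlyap k beta)) x.
Proof.
move=> k2 b0; apply: derive_ge0 => h h0; rewrite !derive_e2_Vlyap// scale_e2D;
  rewrite (ler_wpM2l (ltW b0))// ler_wpM2l; try lra;
  rewrite signed_powR_homo//=; lra.
Qed.

End Derivatives.

(** * Absorption of lower order terms *)

(** The largest of the three terms [1], [|x.1|], [|x.2|] is at least a third of
their sum. *)
Lemma weight_le_Vlyap (R : realType) (k beta : R) : 0 < k -> 0 < beta ->
  exists2 c : R, 0 < c &
    forall x, (1 + norm1 x) `^ k <= c * (1 + Vlyap k beta x).
Proof.
move=> k0 b0; have t0 : 0 < 3 `^ k :> R by rewrite powR_gt0.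
have bV0 : 0 < beta^-1 by rewrite invr_gt0.
exists (3 `^ k * (1 + beta^-1)) => [|x]; first by rewrite mulr_gt0//; lra.
have x1_ge0 : 0 <= `|x.1| `^ k := powR_ge0 _ _.
have x2_ge0 : 0 <= beta * `|x.2| `^ k by rewrite mulr_ge0 ?powR_ge0// ltW.
have W0 : 0 <= 1 + norm1 x by rewrite /norm1 !addr_ge0.
have bound y : 0 <= y -> 1 + norm1 x <= 3 * y ->
    (1 + norm1 x) `^ k <= 3 `^ k * y `^ k.
  move=> y0 Wy; rewrite -powRM//; apply: ge0_ler_powR => //.
  - exact: ltW.
  - by rewrite nnegrE mulr_ge0.
rewrite -mulrA; have [W3|W3] := leP (1 + norm1 x) (3 * 1).
  apply: le_trans (bound _ ler01 W3) _; rewrite powR1 ler_pM2l// /Vlyap.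
  by nra.
have [W1|W1] := leP (1 + norm1 x) (3 * `|x.1|).
  apply: le_trans (bound _ (normr_ge0 _) W1) _; rewrite ler_pM2l// /Vlyap.
  by nra.
have W2 : 1 + norm1 x <= 3 * `|x.2| by move: W3 W1; rewrite /norm1; lra.
apply: le_trans (bound _ (normr_ge0 _) W2) _; rewrite ler_pM2l// /Vlyap.
have {1}-> : `|x.2| `^ k = beta^-1 * (beta * `|x.2| `^ k).
  by rewrite mulrA mulVf ?mul1r// gt_eqF.
by nra.
Qed.

(** With [W = 1 + |x|], either [W <= K / delta], and [K W ^ (k - 1)] is bounded,
or [K W ^ (k - 1) <= delta W ^ k]; then [2 delta W ^ k] is at most
[eps (1 + V)] for [delta] small. *)
Lemma absorb_lower_order (R : realType) (k beta K eps : R) :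
  1 <= k -> 0 < beta -> 0 <= K -> 0 < eps ->
  exists2 delta : R, 0 < delta & exists C : R, forall x,
    K * (1 + norm1 x) `^ (k - 1) + delta * (1 + norm1 x) `^ k <=
      C + eps * Vlyap k beta x.
Proof.
move=> k1 b0 K0 eps0; have k0 : 0 < k by lra.
have [c c0 Wc] := weight_le_Vlyap k0 b0.
pose delta := eps / (2 * c).
have d0 : 0 < delta by rewrite divr_gt0// mulr_gt0.
exists delta => //; exists (eps + K * (K / delta) `^ (k - 1)) => x.
have W0 : 0 <= 1 + norm1 x by rewrite /norm1 !addr_ge0.
have dW : 2 * (delta * (1 + norm1 x) `^ k) <= eps * (1 + Vlyap k beta x).
  have := ler_wpM2l (ltW eps0) (Wc x).
  rewrite -(ler_pM2l (_ : 0 < c^-1)) ?invr_gt0// => le1.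
  apply: le_trans (le_trans le1 _); rewrite le_eqVlt; apply/orP; left; apply/eqP.
    by rewrite /delta; field; rewrite gt_eqF.
  by field; rewrite gt_eqF.
suff KW : K * (1 + norm1 x) `^ (k - 1) <=
    delta * (1 + norm1 x) `^ k + K * (K / delta) `^ (k - 1) by lra.
have [WK|KW] := leP (1 + norm1 x) (K / delta).
  apply: (@le_trans _ _ (K * (K / delta) `^ (k - 1))).
    rewrite ler_wpM2l//; apply: ge0_ler_powR; rewrite ?nnegrE ?subr_ge0//.
    exact: le_trans WK.
  by rewrite lerDr mulr_ge0 ?powR_ge0// ltW.
rewrite -(mulr_powRB1 W0 k0) mulrA.
apply: (@le_trans _ _ (delta * (1 + norm1 x) * (1 + norm1 x) `^ (k - 1))).
  rewrite ler_wpM2r ?powR_ge0// mulrC -ler_pdivrMr//; exact: ltW.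
by rewrite lerDl mulr_ge0 ?powR_ge0.
Qed.

(** * Uniform boundedness over a family of states *)

Section BoundedOn.
Context {R : realType} {T : Type}.
Implicit Types (A : set T) (f g : T -> R).

(** The O(1) of asymptotic estimates.  It is used for sets [A] of pairs of a system
index and a state, so that the bound is uniform in both. *)
Definition bounded_on A f := exists M, forall a, A a -> `|f a| <= M.

Lemma bounded_on_ext A f g :
  (forall a, A a -> f a = g a) -> bounded_on A g -> bounded_on A f.
Proof. by move=> fg [M gM]; exists M => a Aa; rewrite fg ?gM. Qed.

Lemma bounded_on_cst A (c : R) : bounded_on A (fun=> c).
Proof. by exists `|c|. Qed.

Lemma bounded_onD A f g : bounded_on A f -> bounded_on A g ->
  bounded_on A (fun a => f a + g a).
Proof.
move=> [M fM] [N gN]; exists (M + N) => a Aa.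
by rewrite (le_trans (ler_normD _ _))// lerD ?fM ?gN.
Qed.

Lemma bounded_onN A f : bounded_on A f -> bounded_on A (fun a => - f a).
Proof. by move=> [M fM]; exists M => a Aa; rewrite normrN fM. Qed.

Lemma bounded_onM A f g : bounded_on A f -> bounded_on A g ->
  bounded_on A (fun a => f a * g a).
Proof.
move=> [M fM] [N gN]; exists (M * N) => a Aa.
by rewrite normrM ler_pM ?fM ?gN.
Qed.

Lemma bounded_on_seq A (i : T -> nat) (u : nat -> R) (l : R) :
  u n @[n --> \oo] --> l -> bounded_on A (fun a => u (i a)).
Proof.
move=> ul; have /cvg_seq_bounded/pinfty_ex_gt0[M M0 /= uM] : cvgn u.
  by apply/cvg_ex; exists l.
by exists M => a _; exact: uM.
Qed.

Lemma bounded_on2 A f g :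
  bounded_on A f /\ bounded_on A g ->
  exists2 M, 0 <= M & forall a, A a -> `|f a| <= M /\ `|g a| <= M.
Proof.
move=> [[M fM] [N gN]]; exists (`|M| + `|N|); first by rewrite addr_ge0.
move=> a Aa; have := fM a Aa; have := gN a Aa.
by have := ler_norm M; have := ler_norm N; split; have := normr_ge0 M;
  have := normr_ge0 N; lra.
Qed.

End BoundedOn.

Ltac bounded_on_tac :=
  repeat first [assumption | apply: bounded_on_cst | apply: bounded_onD
    | apply: bounded_onM | apply: bounded_onN].

(** * Rounding in the scheduling policy *)

Section Rounding.
Context {R : realType}.
Implicit Types (x y : R).

Lemma pos_ge0 x : 0 <= pos x. Proof. by rewrite /pos le_max lexx orbT. Qed.

Lemma neg_pos x : neg x = pos (- x).
Proof. by rewrite /neg /pos oppr_min oppr0. Qed.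

Lemma pos_le_norm x : pos x <= `|x|.
Proof. by rewrite /pos ge_max ler_norm normr_ge0. Qed.

Lemma pos_lip x y : `|pos x - pos y| <= `|x - y|.
Proof.
wlog xy : x y / x <= y => [hw|].
  have [|/ltW] := leP x y; first exact: hw.
  by move=> ba; rewrite distrC (distrC x) hw.
rewrite distrC (distrC x) /pos /Num.max.
by case: ltP => b0; case: ltP => a0; rewrite !ger0_norm; lra.
Qed.

Lemma posM (s : R) x : 0 <= s -> s * pos x = pos (s * x).
Proof. by move=> s0; rewrite /pos maxr_pMr// mulr0. Qed.

Lemma varpi_dist (t : R) (u : R * R) : edot u = 1 ->
  `|(varpi (t *: u)).1 - t * u.1| <= 1 /\ `|(varpi (t *: u)).2 - t * u.2| <= 1.
Proof.
case: u => u1 u2; rewrite /edot /= => u12.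
rewrite /varpi /edot /= -[t *: u1]/(t * u1) -[t *: u2]/(t * u2).
have /andP[flo] := floor_itv (t * u1); rewrite intrD => fhi.
have t12 : t * u1 + t * u2 = t by rewrite -mulrDr u12 mulr1.
by split; rewrite ler_norml; apply/andP; split; lra.
Qed.

(** Rounding costs at most one customer in each coordinate, which [s <= 1] keeps
bounded; a bounded change of the total to be split changes the parts by a bounded
amount, the shares being in [[0, 1]]. *)
Lemma bounded_on_varpi (T : Type) (A : set T) (s t t' : T -> R)
    (u : T -> R * R) :
  (forall a, A a -> 0 <= s a <= 1) ->
  (forall a, A a -> [/\ 0 <= (u a).1, 0 <= (u a).2 & edot (u a) = 1]) ->
  bounded_on A (fun a => s a * t a - t' a) ->
  bounded_on A
    (fun a => s a * (varpi (pos (t a) *: u a)).1 - pos (t' a) * (u a).1) /\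
  bounded_on A
    (fun a => s a * (varpi (pos (t a) *: u a)).2 - pos (t' a) * (u a).2).
Proof.
move=> s01 uP [M tM].
have err (c d : R) a : A a -> 0 <= d <= 1 -> `|c - pos (t a) * d| <= 1 ->
    `|s a * c - pos (t' a) * d| <= 1 + M.
  move=> Aa /andP[d0 d1] cd; have /andP[s0 s1] := s01 a Aa.
  have -> : s a * c - pos (t' a) * d =
      s a * (c - pos (t a) * d) + (s a * pos (t a) - pos (t' a)) * d by ring.
  rewrite (le_trans (ler_normD _ _))// !normrM lerD//.
    by rewrite (ger0_norm s0) mulr_ile1.
  rewrite posM// (ger0_norm d0) (@le_trans _ _ (`|s a * t a - t' a| * 1))//.
    by rewrite ler_pM// pos_lip.
  by rewrite mulr1 tM.
split; exists (1 + M) => a Aa; have [u1 u2 u12] := uP a Aa;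
  have [w1 w2] := varpi_dist (pos (t a)) u12; move: u12; rewrite /edot => u12.
- by apply: err => //; apply/andP; split => //; lra.
- by apply: err => //; apply/andP; split => //; lra.
Qed.

End Rounding.

(** * The chain on the diffusion scale *)

Lemma cvg_pair1 (R : realType) (u : nat -> R * R) (l : R * R) :
  u n @[n --> \oo] --> l -> (u n).1 @[n --> \oo] --> l.1.
Proof. by move=> ul; apply: cvg_comp ul _; exact: cvg_fst. Qed.

Lemma cvg_pair2 (R : realType) (u : nat -> R * R) (l : R * R) :
  u n @[n --> \oo] --> l -> (u n).2 @[n --> \oo] --> l.2.
Proof. by move=> ul; apply: cvg_comp ul _; exact: cvg_snd. Qed.

(** A function of pairs, although the state does not occur in it, so as to enter
products of families that are bounded over indices and states at once. *)
Definition sqrtn {R : realType} (a : nat * (R * R)) : R := Num.sqrt a.1%:R.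

Section DiffusionScale.
Context {R : realType} (net : nnetwork R) (c0 : R).
Context (v : R * R -> (R * R) * (R * R)).
Context (net_ok : standing net).
Context (v_ctrl : forall x, Uset (v x)).
Implicit Types (a : nat * (R * R)).

Definition scaled_states : set (nat * (R * R)) :=
  [set a | (0 < a.1)%N /\ breveS net c0 a.1 a.2].

Local Notation A := scaled_states.

Let sqrtn_gt0 a : A a -> 0 < sqrtn a.
Proof. by move=> [n0 _]; rewrite /sqrtn sqrtr_gt0 ltr0n. Qed.

Let sqrtn_neq0 a : A a -> sqrtn a != 0.
Proof. by move=> /sqrtn_gt0/gt_eqF ->. Qed.

Let index_sqrtn a : (a.1%:R : R) = sqrtn a ^+ 2.
Proof. by rewrite /sqrtn sqr_sqrtr. Qed.

Let scale01 a : A a -> 0 <= (sqrtn a)^-1 <= 1.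
Proof.
move=> Aa; rewrite invr_ge0 ltW ?sqrtn_gt0//= invf_le1 ?sqrtn_gt0//.
rewrite /sqrtn -[leLHS]sqrtr1 ler_wsqrtr// ler1n; by case: Aa.
Qed.

Lemma scaled_statesP a : A a -> norm1 a.2 <= c0 * sqrtn a.
Proof.
move=> Aa; have r0 := sqrtn_gt0 Aa; case: (Aa) => _ [x [_ xc]] <-.
rewrite /hatx -/(sqrtn a) -(ler_pM2l r0) mulrCA -expr2 -index_sqrtn.
apply: le_trans xc; rewrite /norm1 /=.
rewrite -![_^-1 *: _]/(_ * _) !normrM normfV (gtr0_norm r0) -mulrDr mulrA.
by rewrite mulfV ?gt_eqF// mul1r.
Qed.

Let bounded_state (f : R * R -> R) : (forall x, `|f x| <= norm1 x) ->
  bounded_on A (fun a => (sqrtn a)^-1 * f a.2).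
Proof.
move=> fx; exists c0 => a Aa; have r0 := sqrtn_gt0 Aa.
rewrite normrM normfV (gtr0_norm r0) mulrC ler_pdivrMr//.
exact: le_trans (fx _) (scaled_statesP Aa).
Qed.

Let edot_norm1 x : `|edot x : R| <= norm1 x.
Proof. exact: ler_normD. Qed.

Let bounded_scale : bounded_on A (fun a => (sqrtn a)^-1).
Proof.
by exists 1 => a Aa; have /andP[s0 s1] := scale01 Aa; rewrite ger0_norm.
Qed.

Let bounded_x1 : bounded_on A (fun a => (sqrtn a)^-1 * a.2.1).
Proof. by apply: (@bounded_state fst) => x; rewrite lerDl. Qed.

Let bounded_x2 : bounded_on A (fun a => (sqrtn a)^-1 * a.2.2).
Proof. by apply: (@bounded_state snd) => x; rewrite lerDr. Qed.

Let bounded_pos : bounded_on A (fun a => (sqrtn a)^-1 * pos (edot a.2)).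
Proof.
apply: (@bounded_state (fun x => pos (edot x))) => x.
by rewrite ger0_norm ?pos_ge0// (le_trans (pos_le_norm _)).
Qed.

Let bounded_neg : bounded_on A (fun a => (sqrtn a)^-1 * neg (edot a.2)).
Proof.
apply: (@bounded_state (fun x => neg (edot x))) => x.
rewrite neg_pos ger0_norm ?pos_ge0// (le_trans (pos_le_norm _))// normrN.
exact: edot_norm1.
Qed.

Let bounded_index (u : nat -> R) (l : R) :
  u n @[n --> \oo] --> l -> bounded_on A (fun a => u a.1).
Proof. exact: bounded_on_seq. Qed.

Let bounded_lam1 : bounded_on A
  (fun a => (sqrtn a)^-1 * (lamn net a.1).1 - sqrtn a * (lam net).1).
Proof.
case: net_ok => _ [_ /cvg_pair1/bounded_index + _ _ _] _ _ _.
apply: bounded_on_ext => a Aa /=; rewrite -/(sqrtn a).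
rewrite -[_^-1 *: _]/(_ * _) -[_%:R *: _]/(_ * _) index_sqrtn.
by field; exact: sqrtn_neq0.
Qed.

Let bounded_lam2 : bounded_on A
  (fun a => (sqrtn a)^-1 * (lamn net a.1).2 - sqrtn a * (lam net).2).
Proof.
case: net_ok => _ [_ /cvg_pair2/bounded_index + _ _ _] _ _ _.
apply: bounded_on_ext => a Aa /=; rewrite -/(sqrtn a).
rewrite -[_^-1 *: _]/(_ * _) -[_%:R *: _]/(_ * _) index_sqrtn.
by field; exact: sqrtn_neq0.
Qed.

Let bounded_pool1 : bounded_on A
  (fun a => (sqrtn a)^-1 * (Nn net a.1).1 - sqrtn a * (nu net).1).
Proof.
case: net_ok => _ [_ _ _ _ /cvg_pair1/bounded_index] + _ _ _.
apply: bounded_on_ext => a Aa /=; rewrite -/(sqrtn a).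
rewrite -[_ *: _]/(_ * (_ * _ - _)) index_sqrtn.
by field; exact: sqrtn_neq0.
Qed.

Let bounded_pool2 : bounded_on A
  (fun a => (sqrtn a)^-1 * (Nn net a.1).2 - sqrtn a * (nu net).2).
Proof.
case: net_ok => _ [_ _ _ _ /cvg_pair2/bounded_index] + _ _ _.
apply: bounded_on_ext => a Aa /=; rewrite -/(sqrtn a).
rewrite -[_ *: _]/(_ * (_ * _ - _)) index_sqrtn.
by field; exact: sqrtn_neq0.
Qed.

Let bounded_mu11 : bounded_on A (fun a => sqrtn a * (mu11n net a.1 - mu11 net)).
Proof. by case: net_ok => _ _ [_ [/bounded_index]]. Qed.

Let bounded_mu12 : bounded_on A (fun a => sqrtn a * (mu12n net a.1 - mu12 net)).
Proof. by case: net_ok => _ _ [_ [_ /bounded_index]]. Qed.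

Let bounded_mu22 : bounded_on A (fun a => sqrtn a * (mu22n net a.1 - mu22 net)).
Proof. by case: net_ok => _ _ [_ [_ _ /bounded_index]]. Qed.

Let bounded_gam1 : bounded_on A (fun a => (gamn net a.1).1).
Proof. by case: net_ok => _ [_ _ /cvg_pair1/bounded_index]. Qed.

Let bounded_gam2 : bounded_on A (fun a => (gamn net a.1).2).
Proof. by case: net_ok => _ [_ _ /cvg_pair2/bounded_index]. Qed.

Let mu_neq0 : mu12 net != 0 /\ mu22 net != 0.
Proof.
by case: net_ok => _ _ _ [_ _ _ [_ m12 m22]] _; rewrite !gt_eqF.
Qed.

(** The critical load condition: at the fluid equilibrium all servers are busy
and no customer waits. *)
Let critical_load : edot (xstar net) = edot (nu net).
Proof.
have [m12 m22] := mu_neq0.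
case: net_ok => _ _ _ [_ _ [_ nu2] _] [_ load].
rewrite /edot /xstar /zstar11 /zstar12 /zstar22 /= -addrA; congr (_ + _).
rewrite -[RHS]mulr1 -load; field.
by rewrite m12 m22 gt_eqF.
Qed.

Let unhatE a : A a -> unhatx net a.1 a.2 =
  (sqrtn a * a.2.1 + sqrtn a ^+ 2 * (xstar net).1,
   sqrtn a * a.2.2 + sqrtn a ^+ 2 * (xstar net).2).
Proof. by move=> Aa; rewrite -index_sqrtn /unhatx; case: a.2 => x y. Qed.

(** Consequently the scaled excess of customers over servers differs from
[e . x] by a bounded amount only. *)
Let bounded_excess : bounded_on A (fun a => (sqrtn a)^-1 *
  (edot (unhatx net a.1 a.2) - edot (Nn net a.1)) - edot a.2).
Proof.
pose d a := - ((sqrtn a)^-1 * (Nn net a.1).1 - sqrtn a * (nu net).1)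
            - ((sqrtn a)^-1 * (Nn net a.1).2 - sqrtn a * (nu net).2).
apply: (@bounded_on_ext _ _ _ _ d) => [a Aa|]; last by bounded_on_tac.
have := critical_load; rewrite /d unhatE// /edot => load; cbn [fst snd].
have -> : (nu net).2 = (xstar net).1 + (xstar net).2 - (nu net).1.
  by rewrite load; ring.
by rewrite /edot; field; exact: sqrtn_neq0.
Qed.

Let bounded_queues : bounded_on A (fun a => (sqrtn a)^-1 * (qpol net v a.1 a.2).1
                                - pos (edot a.2) * (v a.2).1.1) /\
         bounded_on A (fun a => (sqrtn a)^-1 * (qpol net v a.1 a.2).2
                                - pos (edot a.2) * (v a.2).1.2).
Proof.
apply: bounded_on_varpi bounded_excess => [|a Aa]; first exact: scale01.
by have [[? ? ? ?] []] := v_ctrl a.2.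
Qed.

Let bounded_idle1 : bounded_on A (fun a => (sqrtn a)^-1 * (ypol net v a.1 a.2).1
                                - neg (edot a.2) * (v a.2).2.1).
Proof.
have bNT : bounded_on A (fun a => (sqrtn a)^-1 *
    - (edot (unhatx net a.1 a.2) - edot (Nn net a.1)) - - edot a.2).
  apply: bounded_on_ext (bounded_onN bounded_excess) => a Aa /=; ring.
have [||+ _] := @bounded_on_varpi _ _ A _ _ _ (fun a => (v a.2).2) _ _ bNT.
- exact: scale01.
- by move=> a Aa; have [[? ? ? ?] []] := v_ctrl a.2.
- by apply: bounded_on_ext => a Aa; rewrite /ypol !neg_pos.
Qed.

Definition departure1 a : R :=
  mu11n net a.1 * zpol net v a.1 a.2 0 0 + mu12n net a.1 * zpol net v a.1 a.2 0 1
  + (gamn net a.1).1 * (qpol net v a.1 a.2).1.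

Definition departure2 a : R :=
  mu22n net a.1 * zpol net v a.1 a.2 1 1
  + (gamn net a.1).2 * (qpol net v a.1 a.2).2.

Let drift1E a : (drift net a.2 (v a.2)).1 =
  - (mu12 net * (a.2.1 - pos (edot a.2) * (v a.2).1.1))
  + neg (edot a.2) * ((mu11 net - mu12 net) * (v a.2).2.1)
  - pos (edot a.2) * ((gam net).1 * (v a.2).1.1) + (ell net).1.
Proof. by []. Qed.

Let drift2E a : (drift net a.2 (v a.2)).2 =
  - (mu22 net * (a.2.2 - pos (edot a.2) * (v a.2).1.2))
  - pos (edot a.2) * ((gam net).2 * (v a.2).1.2) + (ell net).2.
Proof.
rewrite [LHS](_ : _ = - (mu22 net * (a.2.2 - pos (edot a.2) * (v a.2).1.2))
  + neg (edot a.2) * (0 * (v a.2).2.2)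
  - pos (edot a.2) * ((gam net).2 * (v a.2).1.2) + (ell net).2)//.
by rewrite mul0r mulr0 addr0.
Qed.

Let control_bounds x :
  [/\ `|(v x).1.1| <= 1, `|(v x).1.2| <= 1 & `|(v x).2.1| <= 1].
Proof.
have [[? ? ? ?] []] := v_ctrl x; rewrite /edot => ? ?.
by split; rewrite ger0_norm//; lra.
Qed.

Let bounded_uc1 : bounded_on A (fun a => (v a.2).1.1).
Proof. by exists 1 => a _; case: (control_bounds a.2). Qed.

Let bounded_uc2 : bounded_on A (fun a => (v a.2).1.2).
Proof. by exists 1 => a _; case: (control_bounds a.2). Qed.

Let bounded_us1 : bounded_on A (fun a => (v a.2).2.1).
Proof. by exists 1 => a _; case: (control_bounds a.2). Qed.

Let departure1E a : A a -> departure1 a =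
  mu11n net a.1 * ((Nn net a.1).1 - (ypol net v a.1 a.2).1)
  + mu12n net a.1 * (sqrtn a * a.2.1 + sqrtn a ^+ 2 * (zstar11 net + zstar12 net)
      - (qpol net v a.1 a.2).1 - ((Nn net a.1).1 - (ypol net v a.1 a.2).1))
  + (gamn net a.1).1 * (qpol net v a.1 a.2).1.
Proof. by move=> Aa; rewrite /departure1 /zpol unhatE// !mxE. Qed.

Let departure2E a : A a -> departure2 a =
  mu22n net a.1 * (sqrtn a * a.2.2 + sqrtn a ^+ 2 * zstar22 net
    - (qpol net v a.1 a.2).2)
  + (gamn net a.1).2 * (qpol net v a.1 a.2).2.
Proof. by move=> Aa; rewrite /departure2 /zpol unhatE// !mxE. Qed.

(** [E1] and [E2] are the errors made by replacing the scaled allocations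
[n^{-1/2} z_11] and [n^{-1/2} z_12] by
[n^{1/2} z_11^* - (e.x)^- u_1^s] and
[n^{1/2} z_12^* + x_1 - (e.x)^+ u_1^c + (e.x)^- u_1^s].
The fluctuations of the service rates, of order [n^{-1/2}], multiply these
allocations, whose quotient by [n^{1/2}] is bounded on the states considered.  The
terms of order [n^{1/2}] cancel by the definition of [zstar12]. *)
Lemma scaled_drift1 : bounded_on A (fun a =>
  (sqrtn a)^-1 * ((lamn net a.1).1 - departure1 a) - (drift net a.2 (v a.2)).1
  + ((gamn net a.1).1 - (gam net).1) * (pos (edot a.2) * (v a.2).1.1)).
Proof.
have [bK1 _] := bounded_queues; have bH1 := bounded_idle1.
have [m12 m22] := mu_neq0.
pose E1 a := ((sqrtn a)^-1 * (Nn net a.1).1 - sqrtn a * (nu net).1)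
  - ((sqrtn a)^-1 * (ypol net v a.1 a.2).1 - neg (edot a.2) * (v a.2).2.1).
pose K1 a := (sqrtn a)^-1 * (qpol net v a.1 a.2).1 - pos (edot a.2) * (v a.2).1.1.
pose E2 a := - K1 a - E1 a.
have bE1 : bounded_on A E1 by rewrite /E1; bounded_on_tac.
have bE2 : bounded_on A E2 by rewrite /E2; bounded_on_tac.
apply: (@bounded_on_ext _ _ _ _ (fun a =>
  ((sqrtn a)^-1 * (lamn net a.1).1 - sqrtn a * (lam net).1)
  - mu11 net * E1 a
  - sqrtn a * (mu11n net a.1 - mu11 net) * ((nu net).1
      - ((sqrtn a)^-1 * neg (edot a.2)) * (v a.2).2.1 + (sqrtn a)^-1 * E1 a)
  - mu12 net * E2 a
  - sqrtn a * (mu12n net a.1 - mu12 net) * ((sqrtn a)^-1 * a.2.1 + zstar12 net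
      - ((sqrtn a)^-1 * pos (edot a.2)) * (v a.2).1.1
      + ((sqrtn a)^-1 * neg (edot a.2)) * (v a.2).2.1 + (sqrtn a)^-1 * E2 a)
  - (gamn net a.1).1 * K1 a - (ell net).1)); last by bounded_on_tac.
move=> a Aa; rewrite drift1E departure1E// /E2 /E1 /K1 /zstar11 /zstar12.
by field; rewrite m12 sqrtn_neq0.
Qed.

Lemma scaled_drift2 : bounded_on A (fun a =>
  (sqrtn a)^-1 * ((lamn net a.1).2 - departure2 a) - (drift net a.2 (v a.2)).2
  + ((gamn net a.1).2 - (gam net).2) * (pos (edot a.2) * (v a.2).1.2)).
Proof.
have [_ bK2] := bounded_queues; have [m12 m22] := mu_neq0.
pose K2 a := (sqrtn a)^-1 * (qpol net v a.1 a.2).2 - pos (edot a.2) * (v a.2).1.2.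
apply: (@bounded_on_ext _ _ _ _ (fun a =>
  ((sqrtn a)^-1 * (lamn net a.1).2 - sqrtn a * (lam net).2)
  + mu22 net * K2 a
  - sqrtn a * (mu22n net a.1 - mu22 net) * ((sqrtn a)^-1 * a.2.2 + zstar22 net
      - ((sqrtn a)^-1 * pos (edot a.2)) * (v a.2).1.2 - (sqrtn a)^-1 * K2 a)
  - (gamn net a.1).2 * K2 a - (ell net).2)); last by bounded_on_tac.
move=> a Aa; rewrite drift2E departure2E// /K2 /zstar22.
by field; rewrite m22 sqrtn_neq0.
Qed.

(** The scaled arrival rate and the scaled drift determine the departure rate, so
that its order of magnitude need not be estimated from the policy again. *)
Let rate_of_drift (b1 b2 : nat * (R * R) -> R) (l : R)
    (d e f : nat * (R * R) -> R) :
  bounded_on A (fun a => (sqrtn a)^-1 * b1 a - sqrtn a * l) ->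
  bounded_on A (fun a => (sqrtn a)^-1 * (b1 a - b2 a) - d a + e a * f a) ->
  bounded_on A (fun a => (sqrtn a)^-1 * d a) -> bounded_on A e ->
  bounded_on A (fun a => (sqrtn a)^-1 * f a) ->
  bounded_on A (fun a => (b1 a) / sqrtn a ^+ 2) /\
  bounded_on A (fun a => (b2 a) / sqrtn a ^+ 2).
Proof.
move=> hb hd hsd he hf.
have hb1 : bounded_on A (fun a => b1 a / sqrtn a ^+ 2).
  apply: (@bounded_on_ext _ _ _ _ (fun a =>
    (sqrtn a)^-1 * ((sqrtn a)^-1 * b1 a - sqrtn a * l) + l));
    last by bounded_on_tac.
  by move=> a Aa; field; exact: sqrtn_neq0.
split=> //; apply: (@bounded_on_ext _ _ _ _ (fun a => b1 a / sqrtn a ^+ 2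
  - (sqrtn a)^-1 * ((sqrtn a)^-1 * (b1 a - b2 a) - d a + e a * f a)
  - (sqrtn a)^-1 * d a + e a * ((sqrtn a)^-1 * f a))); last by bounded_on_tac.
by move=> a Aa; field; exact: sqrtn_neq0.
Qed.

Lemma fluid_rates1 : bounded_on A (fun a => (lamn net a.1).1 / sqrtn a ^+ 2) /\
  bounded_on A (fun a => departure1 a / sqrtn a ^+ 2).
Proof.
apply: (rate_of_drift bounded_lam1 scaled_drift1).
- apply: (@bounded_on_ext _ _ _ _ (fun a =>
    - (mu12 net * ((sqrtn a)^-1 * a.2.1
        - ((sqrtn a)^-1 * pos (edot a.2)) * (v a.2).1.1))
    + ((sqrtn a)^-1 * neg (edot a.2)) * ((mu11 net - mu12 net) * (v a.2).2.1)
    - ((sqrtn a)^-1 * pos (edot a.2)) * ((gam net).1 * (v a.2).1.1)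
    + (sqrtn a)^-1 * (ell net).1)); last by bounded_on_tac.
  by move=> a Aa; rewrite drift1E; ring.
- by bounded_on_tac.
- apply: (@bounded_on_ext _ _ _ _ (fun a =>
    ((sqrtn a)^-1 * pos (edot a.2)) * (v a.2).1.1)); last by bounded_on_tac.
  by move=> a Aa; ring.
Qed.

Lemma fluid_rates2 : bounded_on A (fun a => (lamn net a.1).2 / sqrtn a ^+ 2) /\
  bounded_on A (fun a => departure2 a / sqrtn a ^+ 2).
Proof.
apply: (rate_of_drift bounded_lam2 scaled_drift2).
- apply: (@bounded_on_ext _ _ _ _ (fun a =>
    - (mu22 net * ((sqrtn a)^-1 * a.2.2
        - ((sqrtn a)^-1 * pos (edot a.2)) * (v a.2).1.2))
    - ((sqrtn a)^-1 * pos (edot a.2)) * ((gam net).2 * (v a.2).1.2)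
    + (sqrtn a)^-1 * (ell net).2)); last by bounded_on_tac.
  by move=> a Aa; rewrite drift2E; ring.
- by bounded_on_tac.
- apply: (@bounded_on_ext _ _ _ _ (fun a =>
    ((sqrtn a)^-1 * pos (edot a.2)) * (v a.2).1.2)); last by bounded_on_tac.
  by move=> a Aa; ring.
Qed.

End DiffusionScale.

(** * The generators at the Lyapunov function *)

Section GeneratorExpansion.
Context {R : realType}.
Implicit Types (k beta s t x : R).

Lemma birth_death_taylor k s t (l d : R) : 2 <= k -> `|s| <= 1 ->
  `|l * (`|t + s| `^ k - `|t| `^ k) + d * (`|t - s| `^ k - `|t| `^ k)
    - s * (l - d) * (k * signed_powR (k - 2) t)| <=
  (`|l| + `|d|) * (k * (k - 1) * (1 + `|t|) `^ (k - 2) * s ^+ 2).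
Proof.
move=> k2 s1; have up := norm_powR_taylor t k2 s1.
have dn := @norm_powR_taylor _ k (- s) t k2; rewrite normrN sqrrN in dn.
set B := k * (k - 1) * _ * _ in up dn *; have {}dn := dn s1.
set g := k * _ in up dn *.
rewrite [X in `|X|](_ : _ = l * (`|t + s| `^ k - `|t| `^ k - s * g)
   + d * (`|t - s| `^ k - `|t| `^ k - - s * g)); last by ring.
by rewrite (le_trans (ler_normD _ _))// !normrM mulrDl lerD// ler_wpM2l.
Qed.

(** Here [r] is the square root of the system size, [l] and [d] are the arrival
and departure rates of one class, and [b] is the drift of the diffusion in that
coordinate.  As [1 <= W], the second order error, of degree [k - 2], is counted with
the terms of degree [k - 1]. *)
Lemma coordinate_bound k (r t W l d b M eta : R) : 2 <= k -> 1 <= r ->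
  1 + `|t| <= W -> `|l / r ^+ 2| <= M -> `|d / r ^+ 2| <= M ->
  `|r^-1 * (l - d) - b| <= M + eta * W ->
  l * (`|t + r^-1| `^ k - `|t| `^ k) + d * (`|t - r^-1| `^ k - `|t| `^ k) <=
    b * (k * signed_powR (k - 2) t)
    + (k * M + 2 * M * (k * (k - 1))) * W `^ (k - 1) + eta * k * W `^ k.
Proof.
move=> k2 r1 tW lM dM bM; have r0 : 0 < r by lra.
have t0 := normr_ge0 t; have W1 : 1 <= W by lra.
have W0 : 0 <= W by lra.
have k0 : 0 < k by lra.
have k10 : 0 < k - 1 by lra.
have s1 : `|r^-1| <= 1 by rewrite normfV gtr0_norm// invf_le1.
have := birth_death_taylor t l d k2 s1; set g := k * signed_powR _ _.
set P := W `^ (k - 1); have P0 : 0 <= P by exact: powR_ge0.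
have gP : `|g| <= k * P.
  rewrite /g /signed_powR normrM (gtr0_norm k0) ler_wpM2l ?(ltW k0)//.
  rewrite normrM (ger0_norm (powR_ge0 _ _)).
  rewrite (_ : k - 2 = k - 1 - 1); last ring.
  by rewrite mulr_powRB1//; apply: ge0_ler_powR; rewrite ?nnegrE; lra.
have hP : (1 + `|t|) `^ (k - 2) <= P.
  apply: (@le_trans _ _ (W `^ (k - 2))).
    by apply: ge0_ler_powR; rewrite ?nnegrE; lra.
  by apply: ler_powR; lra.
have second : (`|l| + `|d|) *
    (k * (k - 1) * (1 + `|t|) `^ (k - 2) * r^-1 ^+ 2) <=
    2 * M * (k * (k - 1)) * P.
  rewrite [leLHS](_ : _ = (`|l / r ^+ 2| + `|d / r ^+ 2|) *
      (k * (k - 1) * (1 + `|t|) `^ (k - 2))); last first.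
    rewrite !normrM normfV normrX (gtr0_norm r0); field; exact: lt0r_neq0.
  rewrite -[leRHS]mulrA; apply: ler_pM; first by rewrite addr_ge0.
  - by rewrite mulr_ge0 ?powR_ge0// mulr_ge0; lra.
  - lra.
  - by rewrite ler_wpM2l//; apply: mulr_ge0; lra.
have first_order : (r^-1 * (l - d) - b) * g <= (M + eta * W) * (k * P).
  rewrite (le_trans (ler_norm _))// normrM; exact: ler_pM.
have WP : W * P = W `^ k by exact: mulr_powRB1.
move=> /(le_trans (ler_norm _))/le_trans/(_ second).
rewrite lerBlDr => /le_trans; apply.
rewrite -WP (_ : r^-1 * (l - d) * g = b * g + (r^-1 * (l - d) - b) * g); last ring.
apply: le_trans (_ : 2 * M * (k * (k - 1)) * P
  + (b * g + (M + eta * W) * (k * P)) <= _).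
  by rewrite !lerD2l.
by rewrite le_eqVlt; apply/orP; left; apply/eqP; ring.
Qed.

Lemma hatx_unhatx_shift (net : nnetwork R) n (xh e : R * R) : (0 < n)%N ->
  hatx net n (unhatx net n xh + e) = xh + (Num.sqrt n%:R)^-1 *: e.
Proof.
move=> n0; have r0 : Num.sqrt n%:R != 0 :> R by rewrite sqrtr_eq0 -ltNge ltr0n.
by rewrite /hatx /unhatx addrAC addrK scalerDr scalerA mulVf// scale1r.
Qed.

Lemma hgen_Vlyap (net : nnetwork R) v n k beta (xh : R * R) : (0 < n)%N ->
  let s := (Num.sqrt n%:R)^-1 in
  hgen net v n (Vlyap k beta) xh =
    ((lamn net n).1 * (`|xh.1 + s| `^ k - `|xh.1| `^ k)
     + departure1 net v (n, xh) * (`|xh.1 - s| `^ k - `|xh.1| `^ k))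
    + beta * ((lamn net n).2 * (`|xh.2 + s| `^ k - `|xh.2| `^ k)
     + departure2 net v (n, xh) * (`|xh.2 - s| `^ k - `|xh.2| `^ k)).
Proof.
move=> n0 s; rewrite /hgen /gen /comp.
have -> : hatx net n (unhatx net n xh) = xh.
  by rewrite -[unhatx _ _ _]addr0 hatx_unhatx_shift// scaler0 addr0.
rewrite !hatx_unhatx_shift// -/s !scalerN -!scaleNr.
rewrite -![xh + _]addrC !scale_e1D !scale_e2D /Vlyap /departure1 /departure2.
cbn [fst snd]; rewrite ![s + _]addrC ![- s + _]addrC; ring.
Qed.

(** The second derivatives of a convex function are nonnegative. *)
Lemma Lgen_Vlyap_ge (net : nnetwork R) u k beta (x : R * R) :
  0 <= (lam net).1 -> 0 <= (lam net).2 -> 2 <= k -> 0 < beta ->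
  (drift net x u).1 * (k * signed_powR (k - 2) x.1)
  + beta * ((drift net x u).2 * (k * signed_powR (k - 2) x.2)) <=
  Lgen net u (Vlyap k beta) x.
Proof.
move=> l1 l2 k2 b0; rewrite /Lgen derive_e1_Vlyap// derive_e2_Vlyap//.
rewrite (mulrCA beta) lerD// lerDr mulr_ge0//.
  exact: derive2_e1_Vlyap_ge0.
exact: derive2_e2_Vlyap_ge0.
Qed.

End GeneratorExpansion.

Theorem lemma9p1 (R : realType) (net : nnetwork R) (c0 : R)
  (v : R * R -> (R * R) * (R * R)) (C1 C2 beta k : R) :
  standing net ->
  0 < c0 -> jwc_radius net c0 ->
  precise_SSM net v ->
  0 < C1 -> 0 < C2 -> 0 < beta -> 2 <= k ->
  (forall x : R * R,
     Lgen net (v x) (Vlyap k beta) x <= C1 - C2 * Vlyap k beta x) ->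
  exists (n0 : nat) (C1' C2' : R),
    0 < C1' /\ 0 < C2' /\
    forall n : nat, (n0 <= n)%N ->
    forall xh : R * R, breveS net c0 n xh ->
      hgen net v n (Vlyap k beta) xh <= C1' - C2' * Vlyap k beta xh.
Proof.
move=> net_ok c00 _ [[_ v_ctrl] _] C10 C20 b0 k2 lyap.
have [Mr Mr0 rates] := bounded_on2 (conj
  (scaled_drift1 c0 net_ok v_ctrl) (scaled_drift2 c0 net_ok v_ctrl)).
have [M1 M10 rates1] := bounded_on2 (fluid_rates1 c0 net_ok v_ctrl).
have [M2 M20 rates2] := bounded_on2 (fluid_rates2 c0 net_ok v_ctrl).
pose M := Mr + M1 + M2; have M0 : 0 <= M by rewrite /M; lra.
have k0 : 0 < k by lra.
have k1 : 1 <= k by lra.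
pose K := k * M + 2 * M * (k * (k - 1)).
have K0 : 0 <= K.
  by rewrite addr_ge0// !mulr_ge0//; lra.
have eps0 : 0 < C2 / 2 by lra.
have bK0 : 0 <= (1 + beta) * K by rewrite mulr_ge0//; lra.
have [delta delta0 [C absorb]] := absorb_lower_order k1 b0 bK0 eps0.
(* [eta] is the tolerated distance of the abandonment rates to their limits: in
   the final sum it contributes [(1 + beta) * eta * k * W `^ k], to be matched with
   [delta * W `^ k]. *)
pose eta := delta / ((1 + beta) * k).
have eta0 : 0 < eta by rewrite divr_gt0// mulr_gt0//; lra.
have [n0 gam_close] : exists n0, forall n, (n0 <= n)%N ->
    `|(gamn net n).1 - (gam net).1| <= eta /\
    `|(gamn net n).2 - (gam net).2| <= eta.
  case: (net_ok) => _ [_ _ gcvg _ _] _ _ _.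
  have /cvgrPdist_le/(_ _ eta0)[N _ NP] := gcvg.
  exists N => n /NP /=; rewrite prod_normE ge_max /= => /andP[g1 g2].
  by rewrite distrC (distrC (gamn net n).2).
exists (maxn n0 1), (C1 + `|C|), (C2 / 2); split; last split => //.
  by rewrite ltr_pwDl.
move=> n; rewrite geq_max => /andP[n0n n1] xh xhS.
have Aa : scaled_states net c0 (n, xh) by split.
have [g1 g2] := gam_close n n0n.
have [d1 d2] := rates _ Aa; have [l1 e1M] := rates1 _ Aa.
have [l2 e2M] := rates2 _ Aa.
cbn [fst snd] in d1, d2, l1, l2, e1M, e2M.
set r := sqrtn (n, xh) in d1 d2 l1 l2 e1M e2M.
have r1 : 1 <= r by rewrite /r /sqrtn -[leLHS]sqrtr1 ler_wsqrtr// ler1n.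
set W := 1 + norm1 xh.
have [[u1 u2 _ _] [u12 _]] := v_ctrl xh; rewrite /edot in u12.
have PW : 0 <= pos (edot xh) <= W.
  rewrite pos_ge0 (le_trans (pos_le_norm _))// (le_trans (ler_normD _ _))//.
  by rewrite /W lerDr.
(* [Mr] bounds the drift error outside the abandonment term [g * (p * w)], whose
   coefficient [g] is small but multiplies a queue of the order of the state. *)
have close (y g p w : R) : `|y + g * (p * w)| <= Mr -> `|g| <= eta ->
    0 <= p <= W -> 0 <= w <= 1 -> `|y| <= M + eta * W.
  move=> ygp geta /andP[p0 pW] /andP[w0 w1].
  rewrite -[y](addrK (g * (p * w))) (le_trans (ler_normB _ _))// lerD//.
    by rewrite (le_trans ygp)// /M; lra.
  rewrite normrM (ger0_norm (mulr_ge0 p0 w0)) ler_pM ?mulr_ge0//.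
  by rewrite -[leRHS]mulr1 ler_pM.
have tW1 : 1 + `|xh.1| <= W by rewrite lerD2l lerDl.
have tW2 : 1 + `|xh.2| <= W by rewrite lerD2l lerDr.
have M1M : M1 <= M by rewrite /M; lra.
have M2M : M2 <= M by rewrite /M; lra.
have w1 : 0 <= (v xh).1.1 <= 1 by rewrite u1; lra.
have w2 : 0 <= (v xh).1.2 <= 1 by rewrite u2; lra.
have B1 := coordinate_bound k2 r1 tW1 (le_trans l1 M1M) (le_trans e1M M1M)
  (close _ _ _ _ d1 g1 PW w1).
have B2 := coordinate_bound k2 r1 tW2 (le_trans l2 M2M) (le_trans e2M M2M)
  (close _ _ _ _ d2 g2 PW w2).
rewrite hgen_Vlyap// -[Num.sqrt _]/r.
apply: le_trans (lerD B1 (ler_wpM2l (ltW b0) B2)) _.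
have drifts : (drift net xh (v xh)).1 * (k * signed_powR (k - 2) xh.1)
  + beta * ((drift net xh (v xh)).2 * (k * signed_powR (k - 2) xh.2))
  <= C1 - C2 * Vlyap k beta xh.
  apply: le_trans (lyap xh); apply: Lgen_Vlyap_ge => //;
  by case: (net_ok) => _ _ _ [[? ?] _ _ _] _; exact: ltW.
have ab := absorb xh; rewrite -/W in ab.
have Wk : (1 + beta) * (eta * k * W `^ k) = delta * W `^ k.
  by rewrite /eta; field; rewrite !gt_eqF//; lra.
have CC := ler_norm C.
rewrite -/K -Wk in ab *.
move: drifts ab CC; move: (_ * (k * signed_powR _ xh.1)) => D1.
move: (_ * (k * signed_powR _ xh.2)) => D2.
move: (W `^ (k - 1)) (W `^ k) => P Q; lra.
Qed.
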